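(* Let $\mathscr S$ be an operator system, let $\mathscr T$ be a unital $C^*$-algebra, let $\mathcal K\subseteq\mathrm{CP}(\mathscr S,\mathscr T)$ and let $\Phi_0\in\mathrm{CP}(\mathscr S,\mathscr T)$. If $\Phi_0\notin\overline{\mathrm{cconv}(\mathcal K)}^{\,\tau}$, then there exists a matrix test $(K,F,S)$ such that $$\Re\,F\big((\Phi_0)_K(S)\big)>\sup_{\Psi\in\mathrm{cconv}(\mathcal K)}\Re\,F\big(\Psi_K(S)\big).$$
   Context: Unital $C^*$-algebras are assumed nonzero ($\mathbb 1\neq 0$). $\mathrm{CP}(\mathscr S,\mathscr T)$ is the set of all completely positive linear maps $\mathscr S\to\mathscr T$. For a linear map $\Phi:\mathscr S\to\mathscr T$ and $k\in\mathbb N$ ($k\ge1$), $\Phi_k:M_k(\mathscr S)\to M_k(\mathscr T)$ is the ampliation $\Phi_k([s_{ij}])=[\Phi(s_{ij})]$. A $C^*$-convex combination of $\Phi_1,\dots,\Phi_n\in \mathrm{CP}(\mathscr S,\mathscr T)$ is a map $\sum_{i=1}^n a_i^*\Phi_i(\cdot)a_i$ with $a_i\in\mathscr T$ and $\sum_{i=1}^n a_i^*a_i=\mathbb 1_{\mathscr T}$ ($n\ge 1$). A subset of $\mathrm{CP}(\mathscr S,\mathscr T)$ is $C^*$-convex if it is closed under all such finite combinations of its elements; $\mathrm{cconv}(\mathcal K)$ is the smallest $C^*$-convex subset of $\mathrm{CP}(\mathscr S,\mathscr T)$ containing $\mathcal K$ (so $\mathrm{cconv}(\varnothing)=\varnothing$).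 A matrix test is a triple $(k,f,s)$ with $k\in\mathbb N$, $f$ a state on $M_k(\mathscr T)$ (positive linear functional with $f(\mathbb 1)=1$), and $s\in M_k(\mathscr S)$. $\mathcal E=\mathrm{span}_{\mathbb C}(\mathrm{CP}(\mathscr S,\mathscr T))$, a complex vector space of linear maps $\mathscr S\to\mathscr T$. $\tau$ is the locally convex topology on $\mathcal E$ generated by the seminorms $p_{k,f,s}(\Phi)=|f(\Phi_k(s))|$ over all matrix tests $(k,f,s)$, and $\overline{\,\cdot\,}^{\,\tau}$ is $\tau$-closure in $\mathcal E$. Suprema are taken in $[-\infty,\infty]$, with $\sup\varnothing=-\infty$. *)

(* Defs.v *)
From HB Require Import structures.
From mathcomp Require Import all_boot all_order all_algebra.
From mathcomp Require Import complex.
From mathcomp Require Import all_classical all_reals all_analysis.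

Set Implicit Arguments.
Unset Strict Implicit.
Unset Printing Implicit Defensive.

Import Order.TTheory GRing.Theory Num.Theory.

Local Open Scope classical_set_scope.
Local Open Scope ring_scope.
Local Open Scope complex_scope.

(* The scalars are R[i], for R : realType. Norms of normed modules over R[i]
   are R[i]-valued, and in the order of R[i], 0 <= z means that z is real and
   nonnegative (in particular 0 < e means that e is a positive real). *)

(* Unital C*-algebras. The ring operations are part of the mixin because
   Hierarchy Builder cannot join the library's normed modules with its rings;
   the ring and algebra structures are derived right below, so that [*], [1]
   and matrices over A are those of the library. *)
HB.mixin Record isCstarAlgebra (R : realType) A
    & CompleteNormedModule R[i] A := {
  cstar_one : A;
  cstar_mul : A -> A -> A;
  star : A -> A;
  cstar_mulA : associative cstar_mul;
  cstar_mul1r : left_id cstar_one cstar_mul;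
  cstar_mulr1 : right_id cstar_one cstar_mul;
  cstar_mulDl : left_distributive cstar_mul +%R;
  cstar_mulDr : right_distributive cstar_mul +%R;
  cstar_scaleAl : forall (c : R[i]) (x y : A),
    c *: cstar_mul x y = cstar_mul (c *: x) y;
  cstar_scaleAr : forall (c : R[i]) (x y : A),
    c *: cstar_mul x y = cstar_mul x (c *: y);
  cstar_one_neq0 : cstar_one != 0;
  cstar_norm_mul_le : forall x y : A, `|cstar_mul x y| <= `|x| * `|y|;
  starK : involutive star;
  star_conj_linear : forall (c : R[i]) (x y : A),
    star (c *: x + y) = c^* *: star x + star y;
  star_mul : forall x y : A, star (cstar_mul x y) = cstar_mul (star y) (star x);
  norm_star_mul : forall x : A, `|cstar_mul (star x) x| = `|x| ^+ 2
}.

#[short(type="cstarAlgType")]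
HB.structure Definition CstarAlgebra (R : realType) :=
  {A of isCstarAlgebra R A & CompleteNormedModule R[i] A}.

HB.instance Definition _ (R : realType) (A : cstarAlgType R) :=
  GRing.Zmodule_isNzRing.Build (CstarAlgebra.sort A) cstar_mulA cstar_mul1r
    cstar_mulr1 cstar_mulDl cstar_mulDr cstar_one_neq0.
HB.instance Definition _ (R : realType) (A : cstarAlgType R) :=
  GRing.Lmodule_isLalgebra.Build R[i] (CstarAlgebra.sort A) cstar_scaleAl.
HB.instance Definition _ (R : realType) (A : cstarAlgType R) :=
  GRing.Lalgebra_isAlgebra.Build R[i] (CstarAlgebra.sort A) cstar_scaleAr.

Section MatrixPositivity.
Variables (R : realType) (A : cstarAlgType R).

Definition adjmx k (X : 'M[A]_k) : 'M[A]_k := (map_mx star X)^T.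

(* The positive elements of the C*-algebra M_k(A). *)
Definition mx_positive k (X : 'M[A]_k) : Prop :=
  exists Y : 'M[A]_k, X = adjmx Y *m Y.

(* In the library 'M[A]_k is a module over A only, so that complex scalar
   multiplication is applied entrywise. *)
Definition is_state k (f : 'M[A]_k -> R[i]) : Prop :=
  [/\ forall (c : R[i]) (X Y : 'M[A]_k),
        f (map_mx ( *:%R c) X + Y) = c * f X + f Y,
      forall X : 'M[A]_k, mx_positive X -> 0 <= f X
    & f 1%:M = 1].

End MatrixPositivity.

(* An operator system: a unital selfadjoint linear subspace (not necessarily
   closed) of a unital C*-algebra. *)
Record opSystem (R : realType) (A : cstarAlgType R) := OpSystem {
  opsys_mem : {pred A};
  opsys_submod : submod_closed opsys_mem;
  opsys_unit : 1 \in opsys_mem;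
  opsys_star : forall x : A, x \in opsys_mem -> star x \in opsys_mem
}.

HB.instance Definition _ (R : realType) (A : cstarAlgType R)
  (S : opSystem A) :=
  GRing.isSubmodClosed.Build R[i] A (opsys_mem S) (opsys_submod S).

Definition opsys_type (R : realType) (A : cstarAlgType R) (S : opSystem A) :=
  {x : A | x \in opsys_mem S}.
Coercion opsys_type : opSystem >-> Sortclass.

HB.instance Definition _ (R : realType) (A : cstarAlgType R)
  (S : opSystem A) := SubChoice.on (opsys_type S).
HB.instance Definition _ (R : realType) (A : cstarAlgType R)
  (S : opSystem A) := [SubChoice_isSubLmodule of opsys_type S by <:].

Section CompletelyPositive.
Variables (R : realType) (A : cstarAlgType R) (S : opSystem A)
  (T : cstarAlgType R).

(* M_k(S) carries the positive cone induced by the inclusion in M_k(A). *)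
Definition opsys_mx_positive k (X : 'M[S]_k) : Prop :=
  mx_positive (map_mx (val : S -> A) X).

Definition ampliation k (Phi : S -> T) (X : 'M[S]_k) : 'M[T]_k :=
  map_mx Phi X.

Definition CP : set (S -> T) := [set Phi | linear Phi /\
  forall k (X : 'M[S]_k), (0 < k)%N ->
    opsys_mx_positive X -> mx_positive (ampliation Phi X)].

Definition cstar_combination n (a : 'I_n -> T) (Phi : 'I_n -> S -> T) :
    S -> T :=
  fun s => \sum_(i < n) star (a i) * Phi i s * a i.

Definition cstar_convex (K : set (S -> T)) : Prop :=
  K `<=` CP /\
  forall n (a : 'I_n -> T) (Phi : 'I_n -> S -> T), (0 < n)%N ->
    (forall i, K (Phi i)) -> \sum_(i < n) star (a i) * a i = 1 ->
    K (cstar_combination a Phi).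

Definition cconv (K : set (S -> T)) : set (S -> T) := smallest cstar_convex K.

Record matrix_test := MatrixTest {
  mt_size : nat;
  mt_size_gt0 : (0 < mt_size)%N;
  mt_state : 'M[T]_mt_size -> R[i];
  mt_stateP : is_state mt_state;
  mt_elt : 'M[S]_mt_size
}.
Arguments mt_state : clear implicits.

Definition mt_eval (t : matrix_test) (Phi : S -> T) : R[i] :=
  mt_state t (ampliation Phi (mt_elt t)).

Definition cp_span : {pred S -> T} := fun Phi => `[<
  exists n (c : 'I_n -> R[i]) (Psi : 'I_n -> S -> T),
    (forall i, CP (Psi i)) /\ Phi = \sum_(i < n) c i *: Psi i >].

Lemma cp_span_submod_closed : submod_closed cp_span.
Proof.
split=> [|c Phi Psi]; rewrite /cp_span !unfold_in.
  apply/asboolP; exists 0%N, (fun=> 0), (fun=> 0).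
  by split=> [[]//|]; rewrite big_ord0.
move=> /asboolP[n [a [F [FCP ->]]]] /asboolP[m [b [G [GCP ->]]]].
apply/asboolP; exists (n + m)%N.
exists (fun k : 'I_(n + m) => match fintype.split k with inl i => c * a i | inr j => b j end).
exists (fun k : 'I_(n + m) => match fintype.split k with inl i => F i | inr j => G j end).
split=> [k|]; first by case: (fintype.split k).
rewrite big_split_ord /= scaler_sumr; congr (_ + _); apply: eq_bigr => i _.
- by have /= -> := unsplitK (inl i : 'I_n + 'I_m); rewrite scalerA.
- by have /= -> := unsplitK (inr i : 'I_n + 'I_m).
Qed.

HB.instance Definition _ :=
  GRing.isSubmodClosed.Build R[i] (S -> T) cp_span cp_span_submod_closed.

Definition cpSpan := {Phi : S -> T | Phi \in cp_span}.

HB.instance Definition _ := SubChoice.on cpSpan.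
HB.instance Definition _ := [SubChoice_isSubLmodule of cpSpan by <:].

Definition mt_seminorm (t : matrix_test) (Phi : cpSpan) : R[i] :=
  `|mt_eval t (val Phi)|.

(* The topology tau: the open balls of the seminorms, around every centre,
   form a subbase. *)
Definition tau_subbase : set (set cpSpan) :=
  [set U | exists t (Phi : cpSpan) (e : R[i]), 0 < e /\
     U = [set Psi | mt_seminorm t (Psi - Phi) < e]].

HB.instance Definition _ :=
  isSubBaseTopological.Build cpSpan tau_subbase id.

Definition tau_closure (X : set (S -> T)) : set (S -> T) :=
  (val : cpSpan -> S -> T) @` closure ((val : cpSpan -> S -> T) @^-1` X).

End CompletelyPositive.

Arguments CP {R A} S T.
Arguments matrix_test {R A} S T.
Arguments cpSpan {R A} S T.

(* Main.v *)
(** The negation of [tau_closure] yields finitely many matrix tests whose joint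
    values on [cconv K] form a convex subset of C^n at positive distance from
    the value at [Phi0]; Hahn-Banach in C^n separates by some real part of
    [sum_j l_j * t_j].  This combination is a single matrix test: average the
    states over the diagonal blocks and evaluate on the block diagonal matrix
    with blocks [n * l_j * s_j].  The average is positive because a block of
    [Y^*Y] is a sum of squares of matrices with one nonzero row.

    When [cconv K] is empty one only needs some state on [T], that is, a
    functional of norm 1 at 1 that is nonnegative on each [y^*y].  This reduces
    to the inequality |1 - y^*y| <= 1 for |y| < 1, proved from the C*-identity
    and square roots of elements near 1, without spectral theory. *)

From HB Require Import structures.
Require Import Defs.
From mathcomp Require Import all_boot all_order all_algebra.
From mathcomp Require Import complex.
From mathcomp Require Import all_classical all_reals all_analysis.
From mathcomp Require Import ring lra.

Set Implicit Arguments.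
Unset Strict Implicit.
Unset Printing Implicit Defensive.

Import Order.TTheory GRing.Theory Num.Theory.

Local Open Scope classical_set_scope.
Local Open Scope ring_scope.
Local Open Scope complex_scope.

(** * Hahn-Banach by minimal sublinear functionals *)

Section HahnBanach.
Variables (R : realType) (V : lmodType R).
Implicit Types (p : V -> R) (x y v d : V) (D : set V).

Definition sublinear p : Prop :=
  (forall x y, p (x + y) <= p x + p y) /\
  (forall (r : R) x, 0 < r -> p (r *: x) <= r * p x).

Lemma sublinear0 p : sublinear p -> p 0 = 0.
Proof.
move=> [_ pZ].
have := pZ 2 0; have := pZ 2^-1 0; rewrite !scaler0 invr_gt0 ltr0n.
by move=> /(_ isT) + /(_ isT); lra.
Qed.

Lemma sublinearZ p r x : sublinear p -> 0 < r -> p (r *: x) = r * p x.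
Proof.
move=> [_ pZ] r0; apply/eqP; rewrite eq_le pZ//=.
rewrite -ler_pdivlMl//; have := pZ r^-1 (r *: x); rewrite invr_gt0 => /(_ r0).
by rewrite scalerA mulVf ?gt_eqF// scale1r.
Qed.

Lemma sublinearN p x : sublinear p -> - p (- x) <= p x.
Proof.
move=> sp; have := sp.1 x (- x); rewrite subrr sublinear0//; lra.
Qed.

(** The infima at [x] and [y] are nearly attained at different indices, so a single index must
    control the sum; the hypotheses supply it. This serves both chains of functionals and shifts of
    one functional. *)
Lemma sublinear_inf (I : Type) (P : set I) (F : I -> V -> R) :
    P !=set0 -> (forall x, has_lbound [set F i x | i in P]) ->
    (forall i j, P i -> P j ->
       exists2 k, P k & forall x y, F k (x + y) <= F i x + F j y) ->
    (forall i (r : R), P i -> 0 < r ->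
       exists2 k, P k & forall x, F k (r *: x) <= r * F i x) ->
  sublinear (fun x => inf [set F i x | i in P]).
Proof.
move=> [i0 Pi0] lb FD FZ.
have ne x : [set F i x | i in P] !=set0 by exists (F i0 x), i0.
have leF i x : P i -> inf [set F i x | i in P] <= F i x.
  by move=> Pi; apply: ge_inf; [exact: lb|exists i].
have approx x e : 0 < e -> exists2 i, P i & F i x < inf [set F i x | i in P] + e.
  move=> e0; have hi : has_inf [set F i x | i in P] by split; [exact: ne|exact: lb].
  by have [_ [i Pi <-] Fi] := inf_adherent e0 hi; exists i.
split=> [x y|r x r0].
  apply/ler_addgt0Pr => e e0.
  have e20 : 0 < e / 2 by rewrite divr_gt0.
  have [i Pi Fi] := approx x _ e20; have [j Pj Fj] := approx y _ e20.
  have [k Pk Fk] := FD i j Pi Pj.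
  have := leF k (x + y) Pk; have := Fk x y; lra.
apply: (@le_trans _ _ (inf [set F i (r *: x) | i in P])) => //.
rewrite -ler_pdivrMl//; apply: lb_le_inf => [//|_ [i Pi <-]].
have [k Pk Fk] := FZ i r Pi r0.
by rewrite ler_pdivrMl//; apply: le_trans (leF k _ Pk) (Fk x).
Qed.

(* Pushing [p] down along the directions of [D] by the amount [e]. *)
Lemma sublinear_shift p D (e : R) :
    sublinear p -> D !=set0 ->
    (forall x y s, D x -> D y -> 0 <= s <= 1 -> D (s *: x + (1 - s) *: y)) ->
    (forall d, D d -> e <= p d) ->
  exists q, [/\ sublinear q, forall x, q x <= p x & forall d, D d -> q (- d) <= - e].
Proof.
move=> sp [d0 Dd0] cD pD.
(* The witness is the infimum of [p (x + l *: d) - l * e] over [l >= 0] and [d] in [D]: [l = 0] puts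
   it below [p], and [l = 1] gives the bound at [- d]. *)
pose P := [set i : R * V | 0 <= i.1 /\ D i.2].
pose F (i : R * V) x := p (x + i.1 *: i.2) - i.1 * e.
have lbF x : has_lbound [set F i x | i in P].
  exists (- p (- x)) => _ [[l d] [/= l0 Dd] <-]; rewrite /F /=.
  have : p (l *: d) <= p (x + l *: d) + p (- x).
    by apply: le_trans (sp.1 _ _); rewrite addrAC subrr add0r.
  have [<-|l0'] := eqVneq 0 l.
    by rewrite scale0r sublinear0// => ?; lra.
  have {l0 l0'} l0 : 0 < l by rewrite lt_neqAle l0'.
  rewrite sublinearZ//; have : l * e <= l * p d by rewrite ler_pM2l// pD.
  lra.
have Pne : P !=set0 by exists (0, d0); split.
have leF i x : P i -> inf [set F i x | i in P] <= F i x.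
  by move=> Pi; apply: ge_inf; [exact: lbF|exists i].
exists (fun x => inf [set F i x | i in P]); split.
- apply: sublinear_inf => //.
    move=> [l d] [m d'] [/= l0 Dd] [/= m0 Dd'].
    have [lm0|lm0] := eqVneq (l + m) 0.
      have [-> ->] : l = 0 /\ m = 0 by split; lra.
      exists (0, d0) => [|x y]; first by split.
      by rewrite /F /= !scale0r !addr0 !mul0r !subr0 sp.1.
    have lmgt0 : 0 < l + m by rewrite lt_neqAle eq_sym lm0 addr_ge0.
    (* [l *: d + m *: d'] is [l + m] times a convex combination of [d] and [d']. *)
    exists (l + m, (l / (l + m)) *: d + (1 - l / (l + m)) *: d').
      split => /=; first exact: ltW.
      by apply: cD => //; rewrite divr_ge0 ?(ltW lmgt0)//= ler_pdivrMr// mul1r lerDl.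
    move=> x y; rewrite /F /= scalerDr !scalerA mulrBr mulr1.
    rewrite [_ * (l / _)]mulrC divfK// [l + m - l]addrAC subrr add0r addrACA.
    have := sp.1 (x + l *: d) (y + m *: d'); lra.
  move=> [l d] r [/= l0 Dd] r0; exists (r * l, d) => [|x].
    by split => //=; rewrite mulr_ge0// ltW.
  rewrite /F /= -scalerA -scalerDr sublinearZ//; lra.
- move=> x; apply: le_trans (leF (0, d0) x _) _; first by split.
  by rewrite /F /= scale0r addr0 mul0r subr0.
- move=> d Dd; apply: le_trans (leF (1, d) (- d) _) _; first by split=> /=.
  by rewrite /F /= scale1r addNr sublinear0// mul1r sub0r.
Qed.

(** Subadditivity at [x + y] and [- y], combined with oddness, is superadditivity. *)
Lemma linear_sublinear p : sublinear p -> (forall x, p (- x) = - p x) ->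
  linear (p : V -> R^o).
Proof.
move=> sp pN.
have pD x y : p (x + y) = p x + p y.
  apply/eqP; rewrite eq_le sp.1/=.
  have := sp.1 (x + y) (- y); rewrite addrK pN; lra.
move=> a x y; rewrite pD; congr (_ + _).
case: (ltgtP a 0) => [a0|a0|->].
- rewrite -[a]opprK scaleNr pN sublinearZ ?oppr_gt0//.
  by rewrite -[RHS]/(_ * _); ring.
- by rewrite sublinearZ.
- by rewrite !scale0r sublinear0.
Qed.

(* A minimal sublinear functional below [p] is linear: otherwise it could be
   pushed down along some direction. *)
Lemma dominated_linear p : sublinear p ->
  exists f : V -> R, linear (f : V -> R^o) /\ forall x, f x <= p x.
Proof.
move=> sp.
pose T := {q : V -> R | sublinear q /\ forall x, q x <= p x}.
(* The order is reversed, so that a maximal element for Zorn's lemma is a minimal functional. *)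
pose below (q q' : T) := `[< forall x, sval q' x <= sval q x >].
have [] := @Zorn T below.
- by move=> q; apply/asboolP.
- move=> q r s /asboolP qr /asboolP rs; apply/asboolP => x.
  exact: le_trans (rs x) (qr x).
- move=> [q hq] [r hr] /asboolP /= qr /asboolP /= rq.
  have E : q = r by apply/funext => x; apply/eqP; rewrite eq_le rq qr.
  by subst r; congr exist; exact: Prop_irrelevance.
- move=> C totC; have [[q0 Cq0]|C0] := pselect (C !=set0); last first.
    exists (exist _ p (conj sp (fun x => lexx _))) => q Cq.
    by exfalso; apply: C0; exists q.
  pose r x := inf [set sval q x | q in C].
  have lb x : has_lbound [set sval q x | q in C].
    exists (- p (- x)) => _ [[q [sq qp]] _ <-] /=.
    by apply: le_trans (sublinearN x sq); rewrite lerN2.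
  have rle q x : C q -> r x <= sval q x.
    by move=> Cq; apply: ge_inf; [exact: lb|exists q].
  have sr : sublinear r.
    apply: (@sublinear_inf _ _ (fun q : T => sval q)) => //.
    - by exists q0.
    - move=> q q' Cq Cq'; have [/asboolP le|/asboolP le] := totC _ _ Cq Cq'.
      + exists q' => // x y; have := (svalP q').1.1 x y; have := le x; lra.
      + exists q => // x y; have := (svalP q).1.1 x y; have := le y; lra.
    - move=> q a Cq a0; exists q => // x; exact: (svalP q).1.2.
  have rp x : r x <= p x by apply: le_trans (rle q0 x Cq0) ((svalP q0).2 x).
  by exists (exist _ r (conj sr rp)) => q Cq; apply/asboolP => x /=; exact: rle.
- move=> [q [sq qp]] qmin; exists q; split => //.
  apply: linear_sublinear => // v; apply/eqP; rewrite eq_le; apply/andP; split.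
    (* Pushing [q] down along [v] alone by [q v] gives [q' (- v) <= - q v], and minimality forces
       [q' = q]. *)
    have [] := @sublinear_shift q [set v] (q v) sq.
    + by exists v.
    + by move=> x y s -> -> _ /=; rewrite -scalerDl addrC subrK scale1r.
    + by move=> d ->.
    move=> q' [sq' q'q q'N].
    have q'p x : q' x <= p x by exact: le_trans (q'q x) (qp x).
    have := qmin (exist _ q' (conj sq' q'p)).
    have -> : below (exist _ q (conj sq qp)) (exist _ q' (conj sq' q'p)).
      by apply/asboolP.
    by move=> /(_ isT) [E]; have := q'N v erefl; rewrite E.
  have := sublinearN (- v) sq; rewrite opprK; lra.
Qed.

(** A linear functional below the shifted one is at most [- e] at [- d], hence at least [e] at
    [d]. *)
Lemma sublinear_separation p D (e : R) :
    sublinear p -> D !=set0 ->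
    (forall x y s, D x -> D y -> 0 <= s <= 1 -> D (s *: x + (1 - s) *: y)) ->
    (forall d, D d -> e <= p d) ->
  exists f : V -> R, [/\ linear (f : V -> R^o), forall x, f x <= p x
    & forall d, D d -> e <= f d].
Proof.
move=> sp D0 cD pD; have [q [sq qp qD]] := sublinear_shift sp D0 cD pD.
have [f [lf fq]] := dominated_linear sq; exists f; split=> // [x|d Dd].
  exact: le_trans (fq x) (qp x).
have f0 : f 0 = 0.
  by have := lf 1 0 0; rewrite !scale1r addr0 => ?; lra.
have fN : f (- d) = - f d.
  by have := lf (-1) d 0; rewrite addr0 f0 addr0 !scaleN1r.
have := fq (- d); have := qD d Dd; rewrite fN; lra.
Qed.

End HahnBanach.

(** * Positivity in C*-algebras *)

Section RealGrowth.
Variable R : realType.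
Implicit Types q d M : R.

Lemma bernoulli_le d n : 0 <= d -> 1 + n%:R * d <= (1 + d) ^+ n.
Proof.
move=> d0; elim: n => [|n IH]; first by rewrite mul0r addr0 expr0.
rewrite exprS -natr1; have := ler_wpM2l (_ : 0 <= 1 + d) IH.
have : 0 <= n%:R * d * d by rewrite !mulr_ge0.
by move=> ? /(_ ltac:(lra)); lra.
Qed.

(** If [q = 1 + d] with [d > 0], the square of Bernoulli's bound makes the left side at [k.+1]
    quadratic in [2 ^ k], while the right side is linear. *)
Lemma le1_of_linear_growth q M : (forall k, q ^+ (2 ^ k) <= 1 + (2 ^ k)%:R * M) ->
  q <= 1.
Proof.
move=> H; rewrite leNgt; apply/negP => q1; pose d := q - 1.
have d0 : 0 < d by rewrite subr_gt0.
have qE : q = 1 + d by rewrite /d addrC subrK.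
have d20 : 0 < d ^+ 2 by rewrite exprn_gt0.
have [k] : exists k, 2 * `|M| / d ^+ 2 < k%:R :> R.
  by exists (Num.bound (2 * `|M| / d ^+ 2)); rewrite archi_boundP// divr_ge0 ?mulr_ge0// ltW.
rewrite ltr_pdivrMr// => kM; have := H k.+1.
rewrite expnSr exprM {1}qE natrM; set N : R := (2 ^ k)%:R => HN.
have N0 : 0 <= N by [].
have kN : k%:R <= N by rewrite ler_nat ltnW// ltn_expl.
have b := @bernoulli_le d (2 ^ k) (ltW d0).
have b2 : (1 + N * d) ^+ 2 <= ((1 + d) ^+ (2 ^ k)) ^+ 2.
  have Nd : 0 <= N * d by rewrite mulr_ge0// ltW.
  by apply: lerXn2r; rewrite ?nnegrE ?exprn_ge0//; lra.
have N1 : 1 <= N by rewrite ler1n expn_gt0.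
have MM := ler_norm M.
have : k%:R * d ^+ 2 <= N * d ^+ 2 by rewrite ler_wpM2r// ltW.
nra.
Qed.

End RealGrowth.

(** * The real-valued norm and the involution *)

Section CstarAlgebra.
Variables (R : realType) (T : cstarAlgType R).
Implicit Types (x y : T) (r s c e : R).

Definition cnorm x : R := complex.Re `|x|.

Lemma normE x : `|x| = (cnorm x)%:C.
Proof. by rewrite RRe_real// ger0_real. Qed.

Lemma cnorm_ge0 x : 0 <= cnorm x.
Proof. by rewrite -ler0c -normE. Qed.

Lemma cnorm0 : cnorm 0 = 0.
Proof. by rewrite /cnorm normr0. Qed.

Lemma cnorm_eq0 x : cnorm x = 0 -> x = 0.
Proof. by move=> x0; apply/normr0_eq0; rewrite normE x0. Qed.

Lemma cnormN x : cnorm (- x) = cnorm x.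
Proof. by rewrite /cnorm normrN. Qed.

Lemma cnormB x y : cnorm (x - y) = cnorm (y - x).
Proof. by rewrite -opprB cnormN. Qed.

Lemma cnormD x y : cnorm (x + y) <= cnorm x + cnorm y.
Proof. by rewrite -lecR rmorphD/= -!normE ler_normD. Qed.

Lemma cnormM x y : cnorm (x * y) <= cnorm x * cnorm y.
Proof. by rewrite -lecR rmorphM/= -!normE; exact: cstar_norm_mul_le. Qed.

Lemma cnormZ (l : R[i]) x : cnorm (l *: x) = complex.Re `|l| * cnorm x.
Proof.
by apply: complexI; rewrite -normE normrZ normE rmorphM/= RRe_real// ger0_real.
Qed.

Lemma cnormZr r x : cnorm (r%:C *: x) = `|r| * cnorm x.
Proof. by rewrite cnormZ normc_def/= expr0n/= addr0 sqrtr_sqr. Qed.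

Lemma starD x y : star (x + y) = star x + star y.
Proof. by have := star_conj_linear 1 x y; rewrite rmorph1 !scale1r. Qed.

Lemma star0 : star (0 : T) = 0.
Proof. by apply: (addrI (star 0)); rewrite -starD !addr0. Qed.

Lemma starZ (l : R[i]) x : star (l *: x) = l^* *: star x.
Proof. by have := star_conj_linear l x 0; rewrite !addr0 star0 addr0. Qed.

Lemma starN x : star (- x) = - star x.
Proof. by rewrite -scaleN1r starZ rmorphN1 scaleN1r. Qed.

Lemma starB x y : star (x - y) = star x - star y.
Proof. by rewrite starD starN. Qed.

Lemma starZr r x : star (r%:C *: x) = r%:C *: star x.
Proof. by rewrite starZ conj_Creal// complex_real. Qed.

Lemma starZi x : star ('i *: x) = - ('i *: star x).
Proof. by rewrite starZ conjCi scaleNr. Qed.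

Lemma starM x y : star (x * y) = star y * star x.
Proof. exact: star_mul. Qed.

Lemma star1 : star (1 : T) = 1.
Proof. by rewrite -[LHS]mulr1 -{2}[1]starK -starM mulr1 starK. Qed.

Lemma starX x n : star (x ^+ n) = star x ^+ n.
Proof. by elim: n => [|n IH]; rewrite ?expr0 ?star1// exprS starM IH -exprSr. Qed.

Lemma cnorm_starM x : cnorm (star x * x) = cnorm x ^+ 2.
Proof.
apply: complexI; rewrite -normE rmorphXn/= -normE; exact: norm_star_mul.
Qed.

(** The C*-identity gives [|z|^2 = |z^*z| <= |z^*| |z|]; the reverse bound is the same one applied
    to [star x]. *)
Lemma cnorm_star x : cnorm (star x) = cnorm x.
Proof.
suff le z : cnorm z <= cnorm (star z).
  by apply/eqP; rewrite eq_le le -{2}[x]starK le.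
have [z0|z0] := eqVneq (cnorm z) 0; first by rewrite z0 cnorm_ge0.
have zgt0 : 0 < cnorm z by rewrite lt_neqAle eq_sym z0 cnorm_ge0.
by rewrite -(ler_pM2r zgt0) -expr2 -cnorm_starM cnormM.
Qed.

Lemma cnorm1 : cnorm 1 = 1.
Proof.
have := cnorm_starM 1; rewrite star1 mul1r expr2 => E.
have n0 : cnorm 1 != 0.
  by apply/eqP => /cnorm_eq0 /eqP; rewrite oner_eq0.
by apply: (mulfI n0); rewrite -E mulr1.
Qed.

Lemma cnormX x n : cnorm (x ^+ n) <= cnorm x ^+ n.
Proof.
elim: n => [|n IH]; first by rewrite !expr0 cnorm1.
rewrite !exprS; apply: le_trans (cnormM _ _) _.
by rewrite ler_wpM2l ?cnorm_ge0.
Qed.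

Lemma cnorm_sa_sqr x : star x = x -> cnorm (x * x) = cnorm x ^+ 2.
Proof. by move=> xs; rewrite -{1}xs cnorm_starM. Qed.

(** This iterated C*-identity stands in for the spectral radius: bounds on the powers [2 ^ k] return
    to [x] itself. *)
Lemma cnorm_sa_exp2 x k : star x = x -> cnorm (x ^+ (2 ^ k)) = cnorm x ^+ (2 ^ k).
Proof.
move=> xs; elim: k => [|k IH]; first by rewrite !expr1.
by rewrite expnSr !exprM expr2 cnorm_sa_sqr ?starX ?xs// IH.
Qed.

Lemma cnorm_small x : (forall e, 0 < e -> cnorm x <= e) -> x = 0.
Proof.
move=> xe; apply: cnorm_eq0; apply/eqP; rewrite eq_le cnorm_ge0 andbT.
by apply/ler_addgt0Pr => e e0; rewrite add0r; exact: xe.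
Qed.

Lemma cnorm_complete (u : nat -> T) :
    (forall e, 0 < e -> exists N, forall n, (N <= n)%N -> cnorm (u n - u N) <= e) ->
  exists l, forall e, 0 < e ->
    exists N, forall n, (N <= n)%N -> cnorm (l - u n) <= e.
Proof.
move=> uC; have /cauchy_cvgP cu : cauchy (u @ \oo).
  apply/cauchy_ballP => e e0; near_simpl; have eE : e = (complex.Re e)%:C.
    by rewrite RRe_real// gtr0_real.
  have re0 : 0 < complex.Re e / 3 by rewrite divr_gt0// -ltcR -eE.
  have [N uN] := uC _ re0.
  exists ([set n | N <= n], [set n | N <= n])%N; first by split; exists N.
  move=> [n m] [/= Nn Nm]; rewrite -ball_normE/= normE eE ltcR.
  have -> : u n - u m = (u n - u N) + (u N - u m) by rewrite addrA subrK.
  have := cnormD (u n - u N) (u N - u m); have := uN n Nn; have := uN m Nm.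
  rewrite [cnorm (u N - u m)]cnormB; lra.
exists (lim (u @ \oo)) => e e0.
have /cvgrPdist_le /(_ e%:C) := cu; rewrite ltcR => /(_ e0) [N _ uN].
by exists N => n Nn; rewrite -lecR -normE; exact: uN.
Qed.

End CstarAlgebra.

(** * Square roots by iteration, and the cone of positive elements *)

Section Positivity.
Variables (R : realType) (T : cstarAlgType R).
Implicit Types (x y z g h k r : T) (s c e : R).

Local Notation "c %:S" := (c%:C *: (1 : T)) (at level 1, format "c %:S").

Lemma scalarMl c x : c%:S * x = c%:C *: x.
Proof. by rewrite -scalerAl mul1r. Qed.

Lemma scalarMr c x : x * c%:S = c%:C *: x.
Proof. by rewrite -scalerAr mulr1. Qed.

Lemma scalar_comm c x : GRing.comm x c%:S.
Proof. by rewrite /GRing.comm scalarMl scalarMr. Qed.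

Lemma scalarD c e : (c + e)%:S = c%:S + e%:S.
Proof. by rewrite rmorphD scalerDl. Qed.

Lemma scalarB c e : (c - e)%:S = c%:S - e%:S.
Proof. by rewrite rmorphB scalerBl. Qed.

Lemma star_scalar c : star c%:S = c%:S.
Proof. by rewrite starZr star1. Qed.

Lemma cnorm_scalar c : cnorm c%:S = `|c|.
Proof. by rewrite cnormZr cnorm1 mulr1. Qed.

(* The root is [1 - w], with [w] the fixed point of the contraction
   [w |-> (k + w^2) / 2] of the ball of radius [cnorm k]. *)
Lemma sqrt_near1 k : star k = k -> cnorm k < 1 ->
  exists r, [/\ star r = r, r * r = 1 - k & forall g, GRing.comm k g -> GRing.comm r g].
Proof.
move=> ks k1; set rho := cnorm k; have rho0 : 0 <= rho := cnorm_ge0 k.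
pose F w := (2^-1)%:C *: (k + w * w).
pose u n := iter n F 0.
have FB x y : cnorm x <= rho -> cnorm y <= rho ->
    cnorm (F x - F y) <= rho * cnorm (x - y).
  move=> xr yr; rewrite /F -scalerBr cnormZr ger0_norm ?invr_ge0//.
  have -> : k + x * x - (k + y * y) = x * (x - y) + (x - y) * y.
    by rewrite mulrBr mulrBl addrA subrK opprD addrACA subrr add0r.
  have := cnormD (x * (x - y)) ((x - y) * y).
  have := cnormM x (x - y); have := cnormM (x - y) y.
  have := ler_wpM2r (cnorm_ge0 (x - y)) xr; have := ler_wpM2l (cnorm_ge0 (x - y)) yr.
  lra.
have ur n : cnorm (u n) <= rho.
  elim: n => [|n IH]; first by rewrite /u/= cnorm0.
  rewrite [u _]/= /F cnormZr ger0_norm ?invr_ge0//.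
  have := cnormD k (u n * u n); have := cnormM (u n) (u n).
  have := cnorm_ge0 (u n); rewrite -/rho => *; nra.
(* Each step contracts by [rho], starting from [u j - u 0 = u j], of norm at most [rho < 1]. *)
have uc n j : cnorm (u (n + j)%N - u n) <= rho ^+ n.
  elim: n => [|n IH]; first by rewrite add0n expr0 subr0; have := ur j; lra.
  rewrite addSn exprS; apply: le_trans (FB _ _ (ur _) (ur _)) _.
  by rewrite ler_wpM2l.
have [|w wu] := @cnorm_complete R T u.
  move=> e e0; have /cvgrPdist_le /(_ e e0) [N _ HN] : (fun n => rho ^+ n) @ \oo --> 0.
    by apply: cvg_expr; rewrite ger0_norm.
  exists N => n Nn; rewrite -(subnKC Nn); apply: le_trans (uc _ _) _.
  by have := HN N (leqnn N); rewrite sub0r normrN ger0_norm// exprn_ge0.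
have {}wu e : 0 < e -> exists n, cnorm (w - u n) <= e /\ cnorm (w - u n.+1) <= e.
  move=> /wu [N HN]; exists N; split; first exact: HN.
  exact/HN/leqnSn.
have wr : cnorm w <= rho.
  apply/ler_addgt0Pr => e /wu [n [wn _]].
  have := cnormD (w - u n) (u n); rewrite subrK; have := ur n; lra.
have Fw : w = F w.
  apply/eqP; rewrite -subr_eq0; apply/eqP/cnorm_small => e e0.
  have e20 : 0 < e / 2 by rewrite divr_gt0.
  have [n [wn wn1]] := wu _ e20.
  have -> : w - F w = (w - u n.+1) + (F (u n) - F w) by rewrite addrA subrK.
  have := cnormD (w - u n.+1) (F (u n) - F w); have := FB _ _ (ur n) wr.
  have := cnorm_ge0 (u n - w); rewrite [cnorm (u n - w)]cnormB; nra.
have us n : star (u n) = u n.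
  by elim: n => [|n IH]; rewrite ?star0// /u/= -/(u n) starZr starD starM IH ks.
have ws : star w = w.
  apply/eqP; rewrite -subr_eq0; apply/eqP/cnorm_small => e e0.
  have e20 : 0 < e / 2 by rewrite divr_gt0.
  have [n [wn _]] := wu _ e20.
  have -> : star w - w = star (w - u n) + (u n - w).
    by rewrite starB us addrA subrK.
  have := cnormD (star (w - u n)) (u n - w).
  rewrite cnorm_star [cnorm (u n - w)]cnormB; lra.
exists (1 - w); split; first by rewrite starB star1 ws.
(* Twice the fixed point equation is exactly what [(1 - w)^2 = 1 - k] says. *)
- have w2 : w + w = k + w * w.
    rewrite {1 2}Fw /F -scalerDl -rmorphD.
    have -> : 2^-1 + 2^-1 = 1 :> R by lra. by rewrite scale1r; reflexivity.
  rewrite mulrBl mul1r mulrBr mulr1 opprB addrACA -opprD w2.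
  by rewrite [k + _]addrC opprD addrA addrK.
- move=> g kg; apply: commr_sym; apply: commrD; first exact: commr1.
  apply: commrN; apply/eqP; rewrite -subr_eq0; apply/eqP/cnorm_small => e e0.
  have g0 := cnorm_ge0 g.
  have g1 : 0 < 2 * (cnorm g + 1) by lra.
  have e20 : 0 < e / (2 * (cnorm g + 1)) by rewrite divr_gt0.
  have [n [wn _]] := wu _ e20.
  have ug m : GRing.comm g (u m).
    elim: m => [|m IH]; first exact: commr0.
    rewrite /u/= -/(u m) /GRing.comm -scalerAl -scalerAr; congr (_ *: _).
    by apply: commrD; [exact/commr_sym|exact: commrM].
  have -> : g * w - w * g = g * (w - u n) + (u n - w) * g.
    by rewrite mulrBr mulrBl -(ug n) addrA subrK.
  have := cnormD (g * (w - u n)) ((u n - w) * g).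
  have := cnormM g (w - u n); have := cnormM (u n - w) g.
  rewrite [cnorm (u n - w)]cnormB.
  move: wn; rewrite ler_pdivlMr//; have := cnorm_ge0 (w - u n); nra.
Qed.

(** Rescaling: [x / c = 1 - k] with [k] of norm below 1, and its root is multiplied by the square
    root of [c]. *)
Lemma sqrt_near c x : star x = x -> cnorm (c%:S - x) < c ->
  exists r, [/\ star r = r, r * r = x & forall g, GRing.comm x g -> GRing.comm r g].
Proof.
move=> xs xc; have c0 : 0 < c by exact: le_lt_trans (cnorm_ge0 _) xc.
pose k := (c^-1)%:C *: (c%:S - x).
have kE : 1 - k = (c^-1)%:C *: x.
  rewrite /k scalerBr scalerA -rmorphM/= mulVf ?gt_eqF// scale1r.
  by rewrite opprB addrC subrK.
have [||r [rs rr rc]] := @sqrt_near1 k.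
- by rewrite starZr starB star_scalar xs.
- by rewrite cnormZr ger0_norm ?invr_ge0 ?ltW// -ltr_pdivlMl ?invr_gt0// invrK mulr1.
exists ((Num.sqrt c)%:C *: r); split.
- by rewrite starZr rs.
- rewrite -scalerAl -scalerAr scalerA -rmorphM/= -expr2 sqr_sqrtr ?ltW//.
  by rewrite rr kE scalerA -rmorphM/= divff ?gt_eqF// scale1r.
- move=> g xg; rewrite /GRing.comm -scalerAl -scalerAr; congr (_ *: _).
  apply: rc; rewrite /k /GRing.comm -scalerAl -scalerAr; congr (_ *: _).
  apply/commr_sym/commrD; first exact: scalar_comm.
  by apply/commrN/commr_sym.
Qed.

(* From [a^2 + b^2 = s^2] follows that [(a + ib)/s] is unitary. *)
Lemma cnorm_le_sqr_sum a b s : star a = a -> star b = b -> GRing.comm a b ->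
  0 <= s -> a * a + b * b = (s ^+ 2)%:S -> cnorm a <= s.
Proof.
move=> sa sb ab s0 abs; pose v := a + 'i *: b.
have vs : star v = a - 'i *: b by rewrite starD starZi sa sb.
have vv : star v * v = (s ^+ 2)%:S.
  rewrite vs /v mulrBl !mulrDr -!scalerAl -!scalerAr -abs scalerA -['i * 'i]expr2.
  by rewrite sqrCi scaleN1r ab opprD opprK addrA addrK.
have vn : cnorm v <= s.
  rewrite -(@ler_pXn2r _ 2) ?nnegrE ?cnorm_ge0// -cnorm_starM vv cnorm_scalar.
  by rewrite ger0_norm ?sqr_ge0.
have : cnorm (2%:C *: a) <= s + s.
  have -> : 2%:C *: a = v + star v.
    by rewrite vs /v addrACA subrr addr0 -[2]/(1 + 1) rmorphD scalerDl scale1r.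
  by apply: le_trans (cnormD _ _) _; rewrite cnorm_star lerD.
rewrite cnormZr ger0_norm//; lra.
Qed.

(* Nonnegative spectrum, phrased by the norm so that sums are immediate. *)
Definition cpos x : Prop :=
  star x = x /\ exists2 c, 0 <= c & cnorm (c%:S - x) <= c.

Lemma cnorm_scalarB_mono c e x : cnorm (c%:S - x) <= c -> c <= e ->
  cnorm (e%:S - x) <= e.
Proof.
move=> xc ce; have -> : e%:S - x = (e - c)%:S + (c%:S - x).
  by rewrite scalarB addrA subrK.
have := cnormD (e - c)%:S (c%:S - x); rewrite cnorm_scalar ger0_norm ?subr_ge0//; lra.
Qed.

Lemma cposD x y : cpos x -> cpos y -> cpos (x + y).
Proof.
move=> [xs [c c0 xc]] [ys [e e0 ye]]; split; first by rewrite starD xs ys.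
exists (c + e); first exact: addr_ge0.
rewrite scalarD opprD addrACA; have := cnormD (c%:S - x) (e%:S - y); lra.
Qed.

(** Adding [e] turns the weak inequality in [cpos] into the strict one needed for a root, with
    constant [c + e]. *)
Lemma cpos_sqrt x e : cpos x -> 0 < e ->
  exists r, [/\ star r = r, r * r = x + e%:S
    & forall g, GRing.comm x g -> GRing.comm r g].
Proof.
move=> [xs [c c0 xc]] e0; have [||r [rs rr rc]] := @sqrt_near (c + e) (x + e%:S).
- by rewrite starD star_scalar xs.
- by rewrite scalarD opprD addrACA subrr addr0; lra.
exists r; split=> // g xg; apply: rc.
by apply/commr_sym/commrD; [exact: commr_sym|exact: scalar_comm].
Qed.

(** For [c > |x|] the element [c^2 - x^2] has a root [r]; then [r^2 + x^2 = c^2] bounds [r] by [c],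
    so [c^2 - x^2] by [c^2]. *)
Lemma cpos_sqr x : star x = x -> cpos (x * x).
Proof.
move=> xs; split; first by rewrite starM xs.
pose c := cnorm x + 1; have c0 : 0 < c by have := cnorm_ge0 x; rewrite /c; lra.
exists (c ^+ 2); first by rewrite exprn_ge0 ?ltW.
have [||r [rs rr rc]] := @sqrt_near (c ^+ 2) ((c ^+ 2)%:S - x * x).
- by rewrite starB star_scalar starM xs.
- rewrite subKr cnorm_sa_sqr// ltr_pXn2r ?nnegrE ?cnorm_ge0 ?ltW//.
  by rewrite /c; lra.
rewrite -rr cnorm_sa_sqr// ler_pXn2r ?nnegrE ?cnorm_ge0 ?(ltW c0)//.
apply: (@cnorm_le_sqr_sum r x); rewrite ?(ltW c0)//.
- apply/rc/commr_sym/commrD; first exact: scalar_comm.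
  by apply/commrN/commrM.
- by rewrite rr subrK.
Qed.

(** With commuting roots [r] of [1 - g + e] and [t] of [1 + g + e], [g^2 + (rt)^2 = (1 + e)^2]. *)
Lemma cnorm_le_of_cpos g : cpos (1 - g) -> cpos (1 + g) -> cnorm g <= 1.
Proof.
move=> gN gP; have gs : star g = g.
  by have := gP.1; rewrite starD star1 => /addrI.
apply/ler_addgt0Pr => e e0.
have [r [rs rr rc]] := cpos_sqrt gN e0; have [t [ts tt tc]] := cpos_sqrt gP e0.
have rg : GRing.comm r g by apply/rc/commr_sym/commrD; [exact: commr1|exact: commrN].
have tg : GRing.comm t g by apply/tc/commr_sym/commrD; [exact: commr1|].
have tr : GRing.comm t r.
  by apply/tc/commr_sym/commrD; [exact: commr1|].
apply: (@cnorm_le_sqr_sum g (r * t)) => //.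
- by rewrite starM rs ts tr.
- by apply: commrM; exact: commr_sym.
- by rewrite addr_ge0 ?ltW.
have -> : r * t * (r * t) = (r * r) * (t * t).
  by rewrite -!mulrA; congr (_ * _); rewrite !mulrA tr.
set u := (1 + e)%:S; have uE : u = 1 + e%:S by rewrite /u scalarD scale1r.
have -> : ((1 + e) ^+ 2)%:S = u * u by rewrite scalarMl scalerA -rmorphM/= -expr2.
rewrite rr tt addrAC -uE addrAC -uE mulrBl !mulrDr (scalar_comm (1 + e) g).
by rewrite [LHS]addrC opprD addrA addrK subrK.
Qed.

(* [x^*x] and [xx^*] have the same nonzero spectrum; here this is read off
   the growth of the powers of [d - x^*x]. *)
Lemma cnorm_swap c d x : 0 < c -> `|d| <= c ->
  cnorm (d%:S - x * star x) <= c -> cnorm (d%:S - star x * x) <= c.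
Proof.
move=> c0 dc; set G' := _ - x * _ => G'c; set G := _ - _ * x.
pose M := cnorm x ^+ 2 / c.
have GG' n : G ^+ n * star x = star x * G' ^+ n.
  elim: n => [|n IH]; first by rewrite !expr0 mul1r mulr1.
  have GG1 : G * star x = star x * G'.
    by rewrite /G /G' mulrBl mulrBr scalarMl scalarMr mulrA.
  by rewrite exprSr -mulrA GG1 mulrA IH -mulrA -exprSr.
have Gn n : cnorm (G ^+ n) <= c ^+ n * (1 + n%:R * M).
  elim: n => [|n IH]; first by rewrite !expr0 mul0r addr0 mul1r cnorm1.
  (* The correction term has norm at most [|x|^2 c^n = c^(n+1) M], so the factor beside [c^n] grows
     only linearly. *)
  have -> : G ^+ n.+1 = d%:C *: G ^+ n - star x * G' ^+ n * x.
    by rewrite exprSr {2}/G mulrBr scalarMr mulrA GG'.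
  have := cnormD (d%:C *: G ^+ n) (- (star x * G' ^+ n * x)); rewrite cnormN cnormZr.
  have := ler_pM (normr_ge0 d) (cnorm_ge0 (G ^+ n)) dc IH.
  have : cnorm (star x * G' ^+ n * x) <= cnorm x * c ^+ n * cnorm x.
    apply: le_trans (cnormM _ _) _; rewrite ler_wpM2r ?cnorm_ge0//.
    apply: le_trans (cnormM _ _) _; rewrite cnorm_star ler_wpM2l ?cnorm_ge0//.
    apply: le_trans (cnormX _ _) _.
    by rewrite lerXn2r ?nnegrE ?cnorm_ge0// ltW.
  have -> : c ^+ n.+1 * (1 + n.+1%:R * M) =
      c * (c ^+ n * (1 + n%:R * M)) + cnorm x * c ^+ n * cnorm x.
    by rewrite /M exprS -natr1; field; rewrite gt_eqF.
  lra.
have Gs : star G = G by rewrite /G starB star_scalar starM starK.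
(* As [G] is selfadjoint, its powers [2 ^ k] have exact norms, and linear growth of
   [(|G| / c)^(2^k)] forces [|G| <= c]. *)
rewrite -[leRHS]mul1r -ler_pdivrMr//; apply: (@le1_of_linear_growth _ _ M) => k.
by rewrite expr_div_n -cnorm_sa_exp2// ler_pdivrMr ?exprn_gt0// mulrC.
Qed.

Lemma cpos_star_add z : cpos (star z * z + z * star z).
Proof.
pose a := z + star z; pose b := 'i *: (z - star z).
pose q := (Num.sqrt 2^-1)%:C : R[i].
have sa : star (q *: a) = q *: a by rewrite starZr /a starD starK addrC.
have sb : star (q *: b) = q *: b.
  by rewrite starZr /b starZi starB starK -scalerN opprB.
have -> : star z * z + z * star z = (q *: a) * (q *: a) + (q *: b) * (q *: b).
  have qq y : (q *: y) * (q *: y) = (2^-1)%:C *: (y * y).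
    by rewrite -scalerAl -scalerAr scalerA -rmorphM/= -expr2 sqr_sqrtr ?invr_ge0.
  rewrite !qq -scalerDr.
  have -> : a * a + b * b = 2%:C *: (star z * z + z * star z).
    rewrite /a /b -scalerAl -scalerAr scalerA -['i * 'i]expr2 sqrCi scaleN1r.
    rewrite !mulrDl !mulrDr !mulNr !mulrN opprK.
    rewrite -[2]/(1 + 1) rmorphD scalerDl scale1r.
    set u := z * z; set v := z * star z; set w := star z * z; set t := star z * star z.
    rewrite !opprD !opprK !addrA (ACl ((1*5)*(4*8)*((3*2)*(7*6))))/=.
    by rewrite !subrr !add0r addrA.
  by rewrite scalerA -rmorphM/= mulVf// scale1r.
by apply: cposD; exact: cpos_sqr.
Qed.

(* If [p = 1 - y^*y] had norm [m > 1], then [g = z^*z] with [z = y p^(n/2)]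
   satisfies [g <= 1], hence [-1 <= zz^*] and [-1 <= g], while
   [g = p^n - p^(n+1)] has norm at least [m^n (m - 1)]. *)
Lemma cnorm_one_sub_starM y : cnorm y < 1 -> cnorm (1 - star y * y) <= 1.
Proof.
move=> y1; have [h hE] : exists h, h = star y * y by exists (star y * y).
rewrite -hE; have hs : star h = h by rewrite hE starM starK.
have [|r [rs rr rc]] := @sqrt_near1 h hs.
  by rewrite hE cnorm_starM; have := cnorm_ge0 y; nra.
have [p pE] : exists p, p = 1 - h by exists (1 - h).
rewrite -pE in rr *.
have rh : GRing.comm r h by exact: rc.
have ps : star p = p by rewrite -rr starM rs.
have rX n : r ^+ n * r ^+ n = p ^+ n by rewrite -exprMn_comm ?rr.
have gle n : cpos (1 - h * p ^+ n).
  elim: n => [|n IH]; first by rewrite expr0 mulr1 -pE -rr; exact: cpos_sqr.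
  have hr : GRing.comm h (r ^+ n) by apply/commrX/commr_sym.
  (* Since [p = 1 - h], passing from [n] to [n.+1] adds the square of the selfadjoint
     [h * r ^+ n]. *)
  have -> : 1 - h * p ^+ n.+1 = (1 - h * p ^+ n) + (h * r ^+ n) * (h * r ^+ n).
    have -> : h * r ^+ n * (h * r ^+ n) = h * p ^+ n * h.
      by rewrite -rX -!mulrA hr.
    rewrite exprSr {2}pE mulrBr mulr1 mulrBr mulrA.
    by rewrite opprB addrA addrAC.
  apply: cposD => //; apply: cpos_sqr.
  by rewrite starM starX rs hs; exact: (commr_sym hr).
have gnorm n : cnorm (h * p ^+ n) <= 1.
  pose z := y * r ^+ n.
  have zz : star z * z = h * p ^+ n.
    rewrite /z starM starX rs mulrA -[_ * star y * y]mulrA -hE -(commrX n (commr_sym rh)).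
    by rewrite -mulrA rX.
  have gp := gle n; rewrite -zz in gp *.
  apply: cnorm_le_of_cpos => //.
  have [] : cpos (1 + z * star z).
    have -> : 1 + z * star z = (1 - star z * z) + (star z * z + z * star z).
      by rewrite addrA subrK.
    by apply: cposD => //; exact: cpos_star_add.
  move=> _ [c c0 zc]; split; first by rewrite starD star1 starM starK.
  have c1 : 0 < c + 1 by lra.
  have shift w : (c + 1)%:S - (1 + w) = c%:S - w.
    by rewrite scalarD scale1r opprD addrA addrK.
  exists (c + 1); first exact: ltW.
  (* Centre [c] and radius [c + 1] encode the lower bound -1, which passes from [z * star z] to
     [star z * z]. *)
  rewrite shift; apply: cnorm_swap => //; first by rewrite ger0_norm//; lra.
  by rewrite -shift; apply: cnorm_scalarB_mono zc _; lra.
pose d := cnorm p - 1; rewrite -subr_le0 -/d leNgt; apply/negP => d0.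
have pd : cnorm p = 1 + d by rewrite /d addrC subrK.
(* The exponent [n.+1] is a power of two, so the norm of [p ^+ n.+1] is exact. The bound becomes
   [d (1 + d)^n <= 1], refuted by Bernoulli as [n d^2 > 1]. *)
have [k kd] : exists k : nat, (d ^+ 2)^-1 < k%:R :> R.
  by exists (Num.bound (d ^+ 2)^-1); rewrite archi_boundP// invr_ge0 exprn_ge0// ltW.
have [n nE] : exists n, (2 ^ k)%N = n.+1.
  by exists (2 ^ k).-1; rewrite prednK// expn_gt0.
have kn : (k <= n)%N by rewrite -ltnS -nE ltn_expl.
have : cnorm (p ^+ (2 ^ k)) <= cnorm p ^+ n + 1.
  have -> : p ^+ (2 ^ k) = p ^+ n - h * p ^+ n by rewrite nE exprS {1}pE mulrBl mul1r.
  apply: le_trans (cnormD _ _) _; rewrite cnormN; apply: lerD (gnorm n).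
  exact: cnormX.
rewrite cnorm_sa_exp2// nE pd exprS.
have := @bernoulli_le R d n (ltW d0).
have : k%:R <= n%:R :> R by rewrite ler_nat.
have d20 : 0 < d ^+ 2 by rewrite exprn_gt0.
move: kd; rewrite -div1r ltr_pdivrMr// => kd kn' b H.
have : d * (1 + n%:R * d) <= d * (1 + d) ^+ n by rewrite ler_pM2l.
have : k%:R * d ^+ 2 <= n%:R * d ^+ 2 by rewrite ler_pM2r.
lra.
Qed.

End Positivity.

(** * Existence of states *)

(** An alias that carries the scaling by [R], apart from the complex module structure of [V]. *)
Definition realified (R : realType) (V : lmodType R[i]) : Type := V.

Section Realified.
Variables (R : realType) (V : lmodType R[i]).

Definition realified_scale (c : R) (x : realified V) : realified V :=
  (c%:C *: (x : V)).

HB.instance Definition _ := GRing.Zmodule.copy (realified V) V.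

Lemma realified_scaleA a b x :
  realified_scale a (realified_scale b x) = realified_scale (a * b) x.
Proof. by rewrite /realified_scale scalerA rmorphM. Qed.

Lemma realified_scale1 : left_id 1 realified_scale.
Proof. by move=> x; rewrite /realified_scale scale1r. Qed.

Lemma realified_scaleDr : right_distributive realified_scale +%R.
Proof. by move=> a x y; exact: scalerDr. Qed.

Lemma realified_scaleDl x : {morph realified_scale^~ x : a b / a + b}.
Proof. by move=> a b; rewrite /realified_scale rmorphD; exact: scalerDl. Qed.

HB.instance Definition _ := GRing.Zmodule_isLmodule.Build R (realified V)
  realified_scaleA realified_scale1 realified_scaleDr realified_scaleDl.

(** For real-linear [f], this is the complex-linear functional with real part [f]. *)
Definition complexify (f : V -> R) (x : V) : R[i] := f x +i* - f ('i *: x).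

Lemma complexify_linear (f : V -> R) :
    linear (f : realified V -> R^o) -> linear (complexify f : V -> R[i]^o).
Proof.
move=> lf; have fD (x y : V) : f (x + y) = f x + f y.
  by have := lf 1 x y; rewrite !scale1r.
have f0 : f 0 = 0 by have := fD 0 0; rewrite addr0 => ?; lra.
have fZ (c : R) (x : V) : f (c%:C *: x) = c * f x.
  by have := lf c x 0; rewrite !addr0 f0 addr0.
have fi (x : V) : f ('i *: ('i *: x)) = - f x.
  have N1 : -1 = (-1)%:C :> R[i] by rewrite rmorphN1.
  rewrite scalerA -expr2 sqrCi N1.
  by rewrite fZ mulN1r.
move=> [a b] x y; rewrite /complexify.
have E : a +i* b = a%:C + b%:C * 'i :> R[i].
  by rewrite -complexiE; simpc.
have -> : f ((a +i* b) *: x + y) = a * f x + b * f ('i *: x) + f y.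
  by rewrite fD E scalerDl -scalerA fD !fZ.
have -> : f ('i *: ((a +i* b) *: x + y)) = a * f ('i *: x) - b * f x + f ('i *: y).
  rewrite scalerDr fD E scalerDl scalerDr fD; congr (_ + _ + _).
    by rewrite scalerA mulrC -scalerA fZ.
  by rewrite scalerA mulrC -!scalerA fZ fi mulrN.
rewrite -[RHS]/((a +i* b) * (f x +i* - f ('i *: x)) + (f y +i* - f ('i *: y))).
by simpc; congr (_ +i* _); ring.
Qed.

End Realified.

Section StateExistence.
Variables (R : realType) (T : cstarAlgType R).

Lemma sublinear_cnorm : sublinear (@cnorm R T : realified T -> R).
Proof.
split=> [x y|c x c0]; first exact: cnormD.
by rewrite [leLHS]cnormZr gtr0_norm.
Qed.

(** Hahn-Banach gives [f] below the norm with value 1 at 1. For [|y| < 1],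
    [1 - f (y^*y) <= |1 - y^*y| <= 1] makes [f (y^*y)] nonnegative. *)
Lemma exists_positive_functional : exists f : T -> R[i],
  [/\ linear (f : T -> R[i]^o), forall x, 0 <= f (star x * x) & f 1 = 1].
Proof.
have [] := @sublinear_separation R (realified T) (@cnorm R T) [set (1 : T)] 1 sublinear_cnorm.
- by exists (1 : T).
- move=> _ _ c -> -> _ /=; rewrite -scalerDl addrC subrK; exact: scale1r.
- by move=> _ ->; rewrite cnorm1.
move=> f [lf fn /(_ (1 : T) erefl) f1].
have fD (x y : T) : f (x + y) = f x + f y.
  by have := lf 1 x y; rewrite !scale1r.
have f0 : f 0 = 0 by have := fD 0 0; rewrite addr0 => ?; lra.
have fZ (c : R) (x : T) : f (c%:C *: x) = c * f x.
  by have := lf c x 0; rewrite !addr0 f0 addr0.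
have f1E : f (1 : T) = 1.
  by apply/eqP; rewrite eq_le f1 andbT; have := fn (1 : T); rewrite cnorm1.
(* Composing with the selfadjoint part makes [g] vanish on [i] times selfadjoint elements, so its
   complexification is real on [star x * x]. *)
pose g (x : T) : R := f ((2^-1)%:C *: (x + star x)).
have gl : linear (g : realified T -> R^o).
  move=> c x y; rewrite /g -[c *: x]/(c%:C *: (x : T)) starD starZr addrACA -scalerDr.
  rewrite fZ fD fZ !fZ -[_ *: _]/(_ * _).
  by rewrite mulrDr; congr (_ + _); ring.
have gsa x : star x = x -> g x = f x.
  by move=> xs; rewrite /g xs fZ fD; lra.
have gi x : star x = x -> g ('i *: x) = 0.
  by move=> xs; rewrite /g starZi xs subrr scaler0 f0.
exists (complexify g); split; first exact: complexify_linear.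
- move=> x; have xs : star (star x * x) = star x * x by rewrite starM starK.
  rewrite /complexify gi// oppr0 gsa// ler0c.
  have [c c0 cx] : exists2 c : R, 0 < c & c * cnorm x < 1.
    have n0 : 0 < cnorm x + 1 by have := cnorm_ge0 x; lra.
    by exists (cnorm x + 1)^-1; rewrite ?invr_gt0// ltr_pdivrMl//; lra.
  have y1 : cnorm (c%:C *: x) < 1 by rewrite cnormZr gtr0_norm.
  have yE : star (c%:C *: x) * (c%:C *: x) = (c * c)%:C *: (star x * x).
    by rewrite starZr -scalerAl -scalerAr scalerA -rmorphM.
  have := cnorm_one_sub_starM y1; rewrite yE.
  have := fn (1 - (c * c)%:C *: (star x * x)).
  have -> : 1 - (c * c)%:C *: (star x * x) = (- (c * c))%:C *: (star x * x) + 1.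
    by rewrite rmorphN scaleNr addrC.
  rewrite fD fZ f1E => h1 h2.
  by rewrite -(pmulr_rge0 _ (mulr_gt0 c0 c0)); lra.
- by rewrite /complexify gi ?star1// gsa ?star1// f1E oppr0.
Qed.

Lemma exists_state : exists f : 'M[T]_1 -> R[i], is_state f.
Proof.
have [f [lf fp f1]] := exists_positive_functional.
exists (fun X => f (X ord0 ord0)); split.
- by move=> c X Y; rewrite !mxE; exact: lf.
- move=> X [Y ->]; rewrite /adjmx !mxE big_ord_recl big_ord0 addr0 !mxE; exact: fp.
- by rewrite mxE.
Qed.

End StateExistence.

(** * Matrix tests *)

Section States.
Variables (R : realType) (T : cstarAlgType R).

Section OneState.
Variables (k : nat) (f : 'M[T]_k -> R[i]).
Hypothesis fS : is_state f.

Lemma stateD X Y : f (X + Y) = f X + f Y.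
Proof.
case: fS => fl _ _; have := fl 1 X Y; rewrite mul1r => <-; congr (f (_ + _)).
by apply/matrixP => i j; rewrite mxE scale1r.
Qed.

Lemma state0 : f 0 = 0.
Proof. by apply: (addrI (f 0)); rewrite -stateD !addr0. Qed.

Lemma stateZ c X : f (map_mx ( *:%R c) X) = c * f X.
Proof. by case: fS => fl _ _; have := fl c X 0; rewrite state0 !addr0. Qed.

Lemma state_sum (I : finType) (F : I -> 'M[T]_k) : f (\sum_i F i) = \sum_i f (F i).
Proof. exact: (big_morph f stateD state0). Qed.

(* [Z^*Z] is the sum over the rows [z] of [Z] of the [Y^*Y], where the square
   matrix [Y] has [z] as its first row and zeros elsewhere. *)
Lemma state_gram_ge0 m (Z : 'M[T]_(m, k)) : (0 < k)%N ->
  0 <= f ((map_mx star Z)^T *m Z).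
Proof.
case: fS => _ fp _ k0; pose i0 := Ordinal k0.
pose Y r : 'M[T]_k := \matrix_(i, j) if i == i0 then Z r j else 0.
have -> : (map_mx star Z)^T *m Z = \sum_r adjmx (Y r) *m Y r.
  apply/matrixP => i j; rewrite summxE mxE; apply: eq_bigr => r _.
  rewrite !mxE (bigD1 i0)//= big1 => [|l /negPf li0]; first by rewrite !mxE eqxx addr0.
  by rewrite !mxE li0 mulr0.
by rewrite state_sum; apply: sumr_ge0 => r _; apply: fp; exists (Y r).
Qed.

End OneState.

Lemma is_state_block n (p : 'I_n -> nat) (f : forall i, 'M[T]_(p i) -> R[i]) :
    (0 < n)%N -> (forall i, 0 < p i)%N -> (forall i, is_state (f i)) ->
  is_state (fun X : 'M[T]_(\sum_i p i) => n%:R^-1 * \sum_i f i (submxblock X i i)).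
Proof.
move=> n0 p0 fS; split.
- move=> c X Y; rewrite mulrCA -mulrDr; congr (_ * _).
  rewrite mulr_sumr -big_split/=; apply: eq_bigr => i _.
  rewrite submxblockD stateD// -(stateZ (fS i)); congr (f i _ + _).
  by apply/matrixP => a b; rewrite !mxE.
- move=> _ [Y ->]; rewrite mulr_ge0 ?invr_ge0 ?ler0n//; apply: sumr_ge0 => i _.
  (* A diagonal block of [Y^*Y] is [Z^*Z] for the rectangular block column [Z] of [Y]. *)
  have -> : submxblock (adjmx Y *m Y) i i =
      (map_mx star (submxrow Y i))^T *m submxrow Y i.
    by apply/matrixP => a b; rewrite !mxE; apply: eq_bigr => l _; rewrite !mxE.
  exact: state_gram_ge0.
- have E i : submxblock (1%:M : 'M[T]_(\sum_i p i)) i i = 1%:M.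
    apply/matrixP => a b; rewrite !mxE; congr (_%:R).
    by rewrite -val_eqE/= tagnat.eq_Rank eqxx.
  rewrite (eq_bigr (fun=> 1)) => [|i _]; last by rewrite E; case: (fS i).
  by rewrite sumr_const card_ord mulVf// pnatr_eq0 -lt0n.
Qed.

End States.

Section MatrixTests.
Variables (R : realType) (A : cstarAlgType R) (S : opSystem A) (T : cstarAlgType R).
Implicit Types (t : matrix_test S T) (F G : S -> T).

Lemma mt_eval_combination t c d F G :
  mt_eval t (fun s => c *: F s + d *: G s) = c * mt_eval t F + d * mt_eval t G.
Proof.
rewrite /mt_eval -!(stateZ (mt_stateP t)) -(stateD (mt_stateP t)); congr mt_state.
by apply/matrixP => i j; rewrite !mxE.
Qed.

Lemma mt_evalD t F G :
  mt_eval t (fun s => F s + G s) = mt_eval t F + mt_eval t G.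
Proof.
rewrite -[mt_eval t F]mul1r -[mt_eval t G]mul1r -mt_eval_combination.
by congr mt_eval; apply/funext => s; rewrite !scale1r.
Qed.

Lemma mt_evalB t F G :
  mt_eval t (fun s => F s - G s) = mt_eval t F - mt_eval t G.
Proof.
rewrite -[mt_eval t F]mul1r -mulN1r -mt_eval_combination.
by congr mt_eval; apply/funext => s; rewrite scale1r scaleN1r.
Qed.

Lemma matrix_test_combination n (t : 'I_n -> matrix_test S T) (c : 'I_n -> R[i]) :
    (0 < n)%N ->
  exists u : matrix_test S T, forall F, linear F ->
    mt_eval u F = \sum_i c i * mt_eval (t i) F.
Proof.
move=> n0; pose p i := mt_size (t i).
have P0 : (0 < \sum_i p i)%N.
  by rewrite (bigD1 (Ordinal n0))//= ltn_addr// mt_size_gt0.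
have FS := is_state_block n0 (fun i => mt_size_gt0 (t i)) (fun i => mt_stateP (t i)).
(* The factor [n] cancels the [n^-1] of the averaged state. *)
pose s : 'M[S]_(\sum_i p i) :=
  \mxdiag_i map_mx ( *:%R (n%:R * c i)) (mt_elt (t i)).
exists (MatrixTest P0 FS s) => F lF; rewrite /mt_eval/= mulr_sumr.
apply: eq_bigr => i _.
have -> : submxblock (ampliation F s) i i =
    map_mx ( *:%R (n%:R * c i)) (ampliation F (mt_elt (t i))).
  have -> : submxblock (ampliation F s) i i = ampliation F (submxblock s i i).
    by apply/matrixP => a b; rewrite !mxE.
  rewrite submxblock_diag; apply/matrixP => a b; rewrite !mxE.
  have F0 : F 0 = 0.
    apply: (addrI (F 0)); have := lF 1 0 0.
    by rewrite !scale1r addr0 => <-; rewrite addr0.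
  by have := lF (n%:R * c i) (mt_elt (t i) a b) 0; rewrite F0 !addr0.
by rewrite (stateZ (mt_stateP _)) !mulrA mulVf ?mul1r// pnatr_eq0 -lt0n.
Qed.

(** The sets containing such a finite intersection of balls centred at [phi] are stable under finite
    intersections, and subbasic sets around [phi] are among them. *)
Lemma nbhs_matrix_tests (phi : cpSpan S T) (U : set (cpSpan S T)) : nbhs phi U ->
  exists (I : finType) (t : I -> matrix_test S T) (e : R), 0 < e /\
    forall Psi, (forall i, mt_seminorm (t i) (Psi - phi) < e%:C) -> U Psi.
Proof.
pose good (B : set (cpSpan S T)) :=
  exists (I : finType) (t : I -> matrix_test S T) (e : R), 0 < e /\
    forall Psi, (forall i, mt_seminorm (t i) (Psi - phi) < e%:C) -> B Psi.
have goodI (B C : set (cpSpan S T)) : good B -> good C -> good (B `&` C).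
  move=> [I [t [e [e0 HB]]]] [J [u [d [d0 HC]]]].
  exists (I + J)%type, (fun k => match k with inl i => t i | inr j => u j end).
  exists (Num.min e d); split=> [|Psi H]; first by rewrite lt_min e0.
  split; [apply: HB => i|apply: HC => j].
    by apply: lt_le_trans (H (inl i)) _; rewrite lecR ge_min lexx.
  by apply: lt_le_trans (H (inr j)) _; rewrite lecR ge_min lexx orbT.
have good_sub (B : set (cpSpan S T)) : tau_subbase B -> B phi -> good B.
  move=> [t [Phi [e [e0 ->]]]] /= phie.
  (* The ball is recentred at [phi]; its new radius is what the triangle inequality leaves of
     [e]. *)
  have eE : e - mt_seminorm t (phi - Phi) =
      (complex.Re (e - mt_seminorm t (phi - Phi)))%:C.
    by rewrite RRe_real// gtr0_real// subr_gt0.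
  exists unit, (fun=> t), (complex.Re (e - mt_seminorm t (phi - Phi))); split.
    by rewrite -ltcR -eE subr_gt0.
  move=> Psi /(_ tt); rewrite -eE ltrBrDr; apply: le_lt_trans.
  have -> : Psi - Phi = (Psi - phi) + (phi - Phi) by rewrite addrA subrK.
  by rewrite /mt_seminorm [val _]raddfD mt_evalD ler_normD.
have good_bigcap (J : choiceType) (s : seq J) (b : J -> set (cpSpan S T)) :
    (forall X, X \in s -> good (b X)) -> good [set Psi | forall X, X \in s -> b X Psi].
  elim: s => [|X s IH] H.
    by exists void, (fun i : void => match i with end), 1; split=> // Psi _ X.
  have /IH gs Y : Y \in s -> good (b Y) by move=> Ys; apply: H; rewrite inE Ys orbT.
  have [I [t [e [e0 He]]]] := goodI _ _ (H X (mem_head _ _)) gs.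
  exists I, t, e; split=> // Psi /He [XPsi sPsi] Y /=.
  by rewrite inE => /orP[/eqP ->//|Ys]; exact: sPsi.
rewrite nbhsE => -[B [oB Bphi] BU].
have [V [goodV VB]] : exists V, good V /\ V `<=` B.
  case: oB Bphi => D' D'sub <- [C D'C Cphi].
  exists C; split; last by move=> x Cx; exists C.
  have [E /= Esub EC] := D'sub C D'C.
  move: Cphi; rewrite -EC => Ephi.
  apply: good_bigcap => X XE; apply: good_sub; last exact: Ephi.
  exact/set_mem/Esub.
have [I [t [e [e0 HV]]]] := goodV.
by exists I, t, e; split=> // Psi /HV /VB /BU.
Qed.

(** Scalar coefficients [sqrt c] and [sqrt (1 - c)] turn a convex combination into a C*-convex
    one. *)
Lemma cconv_segment (K : set (S -> T)) F G c : 0 <= c <= 1 ->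
  cconv K F -> cconv K G ->
  cconv K (fun s => c%:C *: F s + (1 - c)%:C *: G s).
Proof.
move=> /andP[c0 c1] KF KG X XK; have [[XCP XC] KX] := XK.
pose a (i : 'I_2) : T := (Num.sqrt (if i == ord0 then c else 1 - c))%:C *: 1.
pose Phi (i : 'I_2) := if i == ord0 then F else G.
have aE i x : star (a i) * x * a i = (if i == ord0 then c else 1 - c)%:C *: x.
  rewrite /a starZr star1 -scalerAr mulr1 -scalerAl mul1r scalerA -rmorphM/=.
  by rewrite -expr2 sqr_sqrtr//; case: ifP => _; rewrite ?subr_ge0.
have -> : (fun s => c%:C *: F s + (1 - c)%:C *: G s) = cstar_combination a Phi.
  apply/funext => s; rewrite /cstar_combination big_ord_recl big_ord_recl big_ord0.
  by rewrite addr0 !aE.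
apply: XC => // [i|].
  by rewrite /Phi; case: ifP => _; [exact: KF XK|exact: KG XK].
rewrite !big_ord_recl big_ord0 addr0 -[star (a ord0)]mulr1 aE.
rewrite -[star (a (lift _ _))]mulr1 aE /= -scalerDl -rmorphD addrC subrK.
exact: scale1r.
Qed.

End MatrixTests.

(** * Separation from the origin in C^n with the l^1 norm *)

Section FiniteDimSeparation.
Variables (R : realType) (n : nat).

Definition sum_moduli (x : 'rV[R[i]]_n) : R := \sum_j complex.Re `|x ord0 j|.

Lemma RRe_norm (z : R[i]) : (complex.Re `|z|)%:C = `|z|.
Proof. by rewrite RRe_real// ger0_real. Qed.

Lemma sublinear_sum_moduli : sublinear (sum_moduli : realified 'rV[R[i]]_n -> R).
Proof.
split=> [x y|c x c0].
  rewrite /sum_moduli -big_split/=; apply: ler_sum => j _.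
  by rewrite -lecR rmorphD/= !RRe_norm mxE ler_normD.
rewrite /sum_moduli mulr_sumr; apply: ler_sum => j _.
by rewrite -lecR rmorphM/= !RRe_norm mxE normrM [`|c%:C|]gtr0_norm// ltcR.
Qed.

Lemma separate_from_origin (D : set 'rV[R[i]]_n) (e : R) : D !=set0 ->
    (forall x y (c : R), D x -> D y -> 0 <= c <= 1 ->
      D (c%:C *: x + (1 - c)%:C *: y)) ->
    (forall d, D d -> e <= sum_moduli d) ->
  exists l : 'I_n -> R[i], forall d, D d ->
    e <= complex.Re (\sum_j l j * d ord0 j).
Proof.
move=> D0 Dc De.
have [f [lf _ fD]] := sublinear_separation sublinear_sum_moduli D0 Dc De.
have lF := complexify_linear lf.
pose F := complexify f.
have F0 : F 0 = 0.
  by apply: (addrI (F 0)); have := lF 1 0 0; rewrite !scale1r addr0 => <-; rewrite addr0.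
have FD : {morph F : x y / x + y}.
  by move=> x y; have := lF 1 x y; rewrite !scale1r.
have FZ c x : F (c *: x) = c * F x.
  by have := lF c x 0; rewrite addr0 -/F F0 addr0.
exists (fun j => F (delta_mx ord0 j)) => d Dd.
have -> : \sum_j F (delta_mx ord0 j) * d ord0 j = F d.
  rewrite [in RHS](row_sum_delta d) (big_morph F FD F0); apply: eq_bigr => j _.
  by rewrite FZ mulrC.
exact: fD.
Qed.

End FiniteDimSeparation.

(** * Reduction to C^n and the separating matrix test *)

Lemma strictly_separating_test (R : realType) (A : cstarAlgType R) (S : opSystem A)
    (T : cstarAlgType R) (K : set (S -> T)) (Phi0 : S -> T) :
    CP S T Phi0 -> ~ tau_closure (cconv K) Phi0 -> cconv K !=set0 ->
  exists (t : matrix_test S T) (e : R), 0 < e /\ forall F, cconv K F ->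
    complex.Re (mt_eval t F) <= complex.Re (mt_eval t Phi0) - e.
Proof.
move=> Phi0_CP Phi0_notin [Psi1 KPsi1].
have span_CP (F : S -> T) : CP S T F -> F \in @cp_span R A S T.
  move=> FCP; apply/asboolP; exists 1%N, (fun=> 1), (fun=> F); split=> //.
  by rewrite big_ord_recl big_ord0 addr0 scale1r.
pose phi0 : cpSpan S T := exist _ Phi0 (span_CP _ Phi0_CP).
(* If no C*-convex set contains [K], then [cconv K] is the intersection of an
   empty family, hence contains [Phi0]; this spares proving that [CP] is
   C*-convex. *)
have cconv_CP : cconv K `<=` CP S T.
  have [[X XK]|noX] := pselect (exists X, cstar_convex X /\ K `<=` X).
    by move=> F /(_ X XK); case: XK => [[XCP _] _]; exact: XCP.
  exfalso; apply: Phi0_notin; exists phi0 => //.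
  apply: subset_closure => X XK; exfalso; apply: noX; by exists X.
have [U phi0U KU] : exists2 U, nbhs phi0 U &
    forall Psi : cpSpan S T, cconv K (val Psi) -> ~ U Psi.
  apply: contra_notP Phi0_notin => noU; exists phi0 => // U phi0U.
  apply: contra_notP noU => UK; exists U => // Psi KPsi UPsi.
  by apply: UK; exists Psi.
have [I [t [e [e0 tU]]]] := nbhs_matrix_tests phi0U.
pose n := #|I|; pose t' (j : 'I_n) := t (enum_val j).
(* Values are taken relative to [Phi0], which thus sits at the origin; a small l^1 norm would put
   [F] in [U]. *)
pose L F : 'rV[R[i]]_n := \row_j (mt_eval (t' j) F - mt_eval (t' j) Phi0).
have far F : cconv K F -> e <= sum_moduli (L F).
  move=> KF; rewrite leNgt; apply/negP => small.
  pose Psi : cpSpan S T := exist _ F (span_CP _ (cconv_CP _ KF)).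
  apply: (KU Psi KF); apply: tU => i.
  rewrite /mt_seminorm [val _]raddfB mt_evalB -[`|_|]RRe_norm ltcR.
  apply: le_lt_trans small; rewrite /sum_moduli (bigD1 (enum_rank i))//= mxE /t' enum_rankK.
  by rewrite lerDl; apply: sumr_ge0 => j _; rewrite -ler0c RRe_norm.
(* Without tests the sum of moduli at [Psi1] would be 0, below [e]. *)
have n0 : (0 < n)%N.
  rewrite lt0n; apply: contraTneq (far _ KPsi1) => nE.
  by rewrite -ltNge /sum_moduli big1// => j; have := ltn_ord j; rewrite {2}nE.
have [] := @separate_from_origin R n [set L F | F in cconv K] e.
- by exists (L Psi1), Psi1.
- move=> _ _ c [F KF <-] [G KG <-] c01.
  exists (fun s => c%:C *: F s + (1 - c)%:C *: G s); first exact: cconv_segment.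
  by apply/rowP => j; rewrite !mxE mt_eval_combination rmorphB rmorph1; ring.
- by move=> _ [F KF <-]; exact: far.
move=> l lD.
(* The sign is flipped because [L] subtracts the value at [Phi0], which must come out larger. *)
have [u uE] := matrix_test_combination t' (fun j => - l j) n0.
exists u, e; split=> // F KF; have := lD _ (ex_intro2 _ _ F KF erefl).
have -> : \sum_j l j * L F ord0 j = mt_eval u Phi0 - mt_eval u F.
  have [lPhi0 _] := Phi0_CP; have [lF _] := cconv_CP _ KF.
  rewrite !uE// -sumrB; apply: eq_bigr => j _; rewrite mxE; ring.
by rewrite raddfB/=; lra.
Qed.

Local Open Scope ereal_scope.

Theorem corollary4p3 (R : realType) (A : cstarAlgType R) (S : opSystem A)
    (T : cstarAlgType R) (K : set (S -> T)) (Phi0 : S -> T)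
    (K_CP : K `<=` CP S T) (Phi0_CP : CP S T Phi0)
    (Phi0_notin : ~ tau_closure (cconv K) Phi0) :
  exists t : matrix_test S T,
    (complex.Re (mt_eval t Phi0))%:E >
    ereal_sup [set (complex.Re (mt_eval t Psi))%:E | Psi in cconv K].
Proof.
have [K0|K0] := pselect (cconv K !=set0).
  have [t [e [e0 tK]]] := strictly_separating_test Phi0_CP Phi0_notin K0.
  (* The uniform gap [e] keeps the inequality strict after taking the supremum. *)
  exists t; apply: (@le_lt_trans _ _ (complex.Re (mt_eval t Phi0) - e)%:E).
    by apply: ge_ereal_sup => _ [F KF <-]; rewrite lee_fin; exact: tK.
  by rewrite lte_fin ltrBlDr ltrDl.
have [f fS] := exists_state T.
(* The supremum is [-oo] here, so the zero matrix of size 1 with any state works. *)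
exists (MatrixTest (ltn0Sn 0) fS (0%R : 'M[S]_1)).
have -> : cconv K = set0.
  by apply/seteqP; split=> // F KF; exfalso; apply: K0; exists F.
by rewrite image_set0 ereal_sup0 ltNyr.
Qed.
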